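(* Let $(G,\cdot,e,\odot)$ be a left group-$e$-semigroup, and let $e\odot G=\{e\odot x: x\in G\}$. Then $e\odot G$ is a subgroup of $(G,\odot)$, and the following are equivalent: (a) $e\odot G$ is an ideal subgroup of $(G,\odot)$; (b) $e\odot e\in Z(G,\odot)$ (equivalently, $e\odot e\in Zt(G,\odot)$); (c) $(G,\odot)$ is a homogroup; (d) $e\odot G$ is the largest subgroup of $(G,\odot)$ containing $e\odot e$ and also the least ideal of $(G,\odot)$.
   Context: A left group-$e$-semigroup $(G,\cdot,e,\odot)$ consists of a group $(G,\cdot)$ with identity element $e$ and a semigroup $(G,\odot)$ on the same set such that the left $e$-join law $e\odot(xy)=e\odot(x\odot y)$ holds for all $x,y\in G$ (where $xy=x\cdot y$). A subgroup of a semigroup is a sub-semigroup that is a group (with its own identity). An ideal means a two-sided ideal, and an ideal subgroup is an ideal that is a subgroup. A homogroup is a semigroup containing an ideal subgroup. $Z(G,\odot)$ is the center of $(G,\odot)$ and $Zt(G,\odot)$ is the set of central idempotents of $(G,\odot)$. *)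

(* Defs.v *)
From mathcomp Require Import all_boot.
From mathcomp Require Import classical_sets.
Set Implicit Arguments. Unset Strict Implicit. Unset Printing Implicit Defensive.

Local Open Scope classical_set_scope.

Definition subsemigroup (T : Type) (op : T -> T -> T) (H : set T) : Prop :=
  H !=set0 /\ forall x y, H x -> H y -> H (op x y).

(* The identity u is that of H: it need not be an identity of (T, op).
   Associativity on H is inherited from (T, op). *)
Definition subgroup (T : Type) (op : T -> T -> T) (H : set T) : Prop :=
  subsemigroup op H /\
  exists2 u, H u &
    (forall x, H x -> op u x = x /\ op x u = x) /\
    (forall x, H x -> exists2 y, H y & op x y = u /\ op y x = u).

(* Ideals are nonempty, as usual in semigroup theory: otherwise the empty set
   would always be the least ideal. *)
Definition ideal (T : Type) (op : T -> T -> T) (I : set T) : Prop :=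
  I !=set0 /\ forall x a, I a -> I (op x a) /\ I (op a x).

Definition ideal_subgroup (T : Type) (op : T -> T -> T) (K : set T) : Prop :=
  ideal op K /\ subgroup op K.

Definition homogroup (T : Type) (op : T -> T -> T) : Prop :=
  associative op /\ exists K : set T, ideal_subgroup op K.

Definition center (T : Type) (op : T -> T -> T) : set T :=
  [set z | forall x, op z x = op x z].

Definition central_idempotents (T : Type) (op : T -> T -> T) : set T :=
  center op `&` [set z | op z z = z].

Definition largest (T : Type) (P : set (set T)) (A : set T) : Prop :=
  P A /\ forall B, P B -> B `<=` A.

Definition least (T : Type) (P : set (set T)) (A : set T) : Prop :=
  P A /\ forall B, P B -> A `<=` B.

(* The element e is the identity 1 of the (possibly infinite) group G. *)
Record left_group_e_semigroup (G : groupType) (op : G -> G -> G) : Prop := {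
  lges_assoc : associative op;
  lges_ejoin : forall x y : G, op 1%g (x * y)%g = op 1%g (op x y)
}.

(* Main.v *)
(* The join law forces x |-> e (.) x to be a homomorphism from the group G onto
   e (.) G, which is therefore a subgroup with identity u = e (.) e, and a right
   ideal.  It is a left ideal as soon as u is central.  Conversely, the identity
   k of an ideal subgroup K is central, so e (.) k is an idempotent of K; hence
   k = e (.) k lies in e (.) G, and k = u. *)
Require Import Defs.
From mathcomp Require Import all_boot.
From mathcomp Require Import classical_sets.
Local Open Scope classical_set_scope.

Section Semigroup.
Context {T : Type} {op : T -> T -> T}.
Hypothesis opA : associative op.

(** Cancelling an idempotent [w] of [H] against its inverse turns [w w = w] into [w = v], the
    identity of [H]. *)
Lemma subgroup_idempotent_id {H : set T} {u z : T} :
  subgroup op H -> H u -> H z -> op u u = u -> op z z = z -> z = u.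
Proof.
move=> [_ [v _ [idv invv]]].
suff eqv w : H w -> op w w = w -> w = v.
  by move=> Hu Hz /(eqv _ Hu) -> /(eqv _ Hz) ->.
move=> Hw ww; have [y _ [wy yw]] := invv w Hw.
by rewrite -(proj1 (idv w Hw)) -{1}yw -opA ww.
Qed.

(** Both [k x] and [x k] lie in [K], where [k] acts as identity: [k x = (k x) k = k (x k) = x k]. *)
Lemma ideal_subgroup_central_id {K : set T} :
  ideal_subgroup op K -> exists k, [/\ K k, op k k = k & center op k].
Proof.
move=> [[_ idealK] [_ [k Kk [idk _]]]]; exists k; split=> // [|x].
  by have [] := idk k Kk.
have [Kxk Kkx] := idealK x k Kk.
by rewrite -(proj2 (idk _ Kkx)) -(proj1 (idk _ Kxk)) opA.
Qed.

(** With [y] the inverse of [a] in [H], each [x] in [H] equals [(y a) x], which the ideal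
    absorbs. *)
Lemma subgroup_sub_ideal {H I : set T} (a : T) :
  subgroup op H -> ideal op I -> H a -> I a -> H `<=` I.
Proof.
move=> [_ [u _ [idu invu]]] [_ idealI] Ha Ia x Hx.
have [y _ [_ ya]] := invu a Ha.
rewrite -(proj1 (idu x Hx)) -ya.
by apply: (proj2 (idealI _ _ _)); apply: (proj1 (idealI _ _ _)).
Qed.

End Semigroup.

Section LeftGroupESemigroup.
Context {G : groupType} {op : G -> G -> G}.
Hypothesis hG : left_group_e_semigroup op.

Let e : G := 1%g.
Let u : G := op e e.
Let eG : set G := [set op e x | x in [set: G]].
Let opA : associative op := lges_assoc hG.

Lemma unit_op_idl (x : G) : op u x = op e x.
Proof. by rewrite /u -opA -(lges_ejoin hG) mul1g. Qed.

Lemma unit_op_mul (x y : G) : op e (x * y)%g = op (op e x) (op e y).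
Proof.
(* The join law at [y = 1] lets [e x] absorb a factor [e] on its right, so
   [(e x)(e y) = (e x) y]. *)
have exe : op (op e x) e = op e x by rewrite -opA -(lges_ejoin hG) mulg1.
by rewrite opA exe -opA; exact: lges_ejoin.
Qed.

Lemma unit_op_idem : op u u = u.
Proof. by rewrite unit_op_idl /u opA unit_op_idl. Qed.

Lemma unit_op_range_subgroup : subgroup op eG.
Proof.
split.
  split; first by exists u; exists e.
  by move=> _ _ [x _ <-] [y _ <-]; exists (x * y)%g => //; apply: unit_op_mul.
exists u; first by exists e.
split=> _ [x _ <-]; first by rewrite -!unit_op_mul mul1g mulg1.
exists (op e x^-1%g); first by exists x^-1%g.
by rewrite -!unit_op_mul mulgV mulVg.
Qed.

Lemma unit_op_range_ideal : center op u -> ideal op eG.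
Proof.
move=> cu; split; first by exists u; exists e.
move=> x _ [y _ <-]; split.
  (* Replacing [e] by [u] makes it movable: [x (e y) = x (u y) = u (x y) = e (x y)]. *)
  by exists (op x y) => //; rewrite -(unit_op_idl y) -(unit_op_idl (op x y)) [LHS]opA cu opA.
by exists (op y x) => //; rewrite opA.
Qed.

Lemma ideal_subgroup_unit_central {K : set G} :
  ideal_subgroup op K -> center op u.
Proof.
move=> idealK; have [k [Kk kk ck]] := ideal_subgroup_central_id opA idealK.
have [[_ clK] sgK] := idealK.
have ek : op e k = k.
  have Kek : K (op e k) by exact: (proj1 (clK e k Kk)).
  apply: (subgroup_idempotent_id opA sgK Kk Kek kk).
  (* Since [k] is a central idempotent, [(e k)(e k) = e (e k) = u k = e k]. *)
  by rewrite -opA [op k (op e k)]opA ck -opA kk opA unit_op_idl.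
suff <- : k = u by [].
apply: (subgroup_idempotent_id opA unit_op_range_subgroup) => //.
- by exists e.
- by exists k.
exact: unit_op_idem.
Qed.

(** The idempotent [u] must be the identity of [H], so every [x] in [H] satisfies
    [x = u x = e x]. *)
Lemma unit_op_range_largest : largest [set H | subgroup op H /\ H u] eG.
Proof.
split; first by split; [exact: unit_op_range_subgroup | exists e].
move=> H [sgH Hu] x Hx; exists x => //.
have [_ [v Hv [idv _]]] := sgH.
have vu : v = u.
  by apply: (subgroup_idempotent_id opA sgH) => //;
     [exact: unit_op_idem | case: (idv v Hv)].
by rewrite -unit_op_idl -vu; case: (idv x Hx).
Qed.

(** Any ideal meets the subgroup [eG], at [e a] for each of its elements [a], and hence contains
    it. *)
Lemma unit_op_range_least : ideal op eG -> least [set I | ideal op I] eG.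
Proof.
move=> ideG; split=> // I idI; have [[a Ia] clI] := idI.
apply: (subgroup_sub_ideal (op e a) unit_op_range_subgroup idI).
  by exists a.
exact: (clI e a Ia).1.
Qed.

End LeftGroupESemigroup.

Theorem theorem2p1 (G : groupType) (op : G -> G -> G)
    (hG : left_group_e_semigroup op) :
  let e : G := 1%g in
  let eG : set G := [set op e x | x in [set: G]] in
  subgroup op eG /\
  [<-> ideal_subgroup op eG;
       center op (op e e);
       central_idempotents op (op e e);
       homogroup op;
       largest [set H | subgroup op H /\ H (op e e)] eG /\
       least [set I | ideal op I] eG].
Proof.
move=> e eG; have sgeG := unit_op_range_subgroup hG.
split=> //; tfae.
- exact: ideal_subgroup_unit_central.
- by move=> cu; split=> //; exact: unit_op_idem.
- move=> [cu _]; split; first exact: lges_assoc hG.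
  by exists eG; split=> //; exact: unit_op_range_ideal.
- move=> [_ [K /(ideal_subgroup_unit_central hG) cu]].
  split; first exact: unit_op_range_largest.
  exact/unit_op_range_least/unit_op_range_ideal.
- by move=> [_ [ideG _]].
Qed.
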